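(* Let $A\in\mathbb{R}^{n\times n}$ be positive definite, $b\in\mathbb{R}^n$, and let $m$ be a nonnegative integer. The sequence $\{x_k,r_k,p_k\}$ generated by SWI with window parameter $m$ satisfies $$x_k\in\mathcal{K}_k\qquad\text{and}\qquad r_k,\,p_k\in\mathcal{K}_{k+1}$$ for every $k\ge0$ for which these vectors are generated.
   Context: A real square (not necessarily symmetric) matrix $A$ is positive definite if $x^TAx>0$ for all nonzero $x\in\mathbb{R}^n$. The Krylov subspace is $\mathcal{K}_k=\mathcal{K}_k(A,r_0)=\mathrm{span}\{r_0,Ar_0,\dots,A^{k-1}r_0\}$, with $\mathcal{K}_0=\{0\}$. SWI (sliding window implementation of the semi-conjugate gradient method), in exact arithmetic, with a nonnegative integer $m$. Set $x_0=0$, $r_0=b$, $p_0=r_0$, $q_0=Ap_0$. For $k=0,1,2,\dots$: compute $\alpha_k=r_k^Tp_k/(p_k^Tq_k)$, $x_{k+1}=x_k+\alpha_kp_k$, $r_{k+1}=r_k-\alpha_kq_k$; let $m_k=\min\{k,m\}$, form $v_{k+1}=Ar_{k+1}$, $P_{k+1}=[p_{k-m_k}\ \cdots\ p_k]$, $Q_{k+1}=[q_{k-m_k}\ \cdots\ q_k]$, $L_{k+1}=P_{k+1}^TQ_{k+1}$, solve $L_{k+1}\lambda_{k+1}=P_{k+1}^Tv_{k+1}$ and set $p_{k+1}=r_{k+1}-P_{k+1}\lambda_{k+1}$, $q_{k+1}=v_{k+1}-Q_{k+1}\lambda_{k+1}$. Iteration $k$ is well defined when $p_k^Tq_k\neq0$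 and $L_{k+1}$ is nonsingular; quantities with index $k$ are ''generated'' if iterations $0,\dots,k-1$ are well defined. *)

(* Defs.v *)
From HB Require Import structures.
From mathcomp Require Import all_boot all_order all_algebra.
From mathcomp Require Import reals.

Set Implicit Arguments.
Unset Strict Implicit.
Unset Printing Implicit Defensive.

Import Order.TTheory GRing.Theory Num.Theory.
Local Open Scope ring_scope.

Definition dotc (R : realType) (n : nat) (u v : 'cV[R]_n) : R :=
  (u^T *m v) 0 0.

(* Symmetry of A is deliberately not required. *)
Definition posdef (R : realType) (n : nat) (A : 'M[R]_n) : Prop :=
  forall x : 'cV[R]_n, x != 0 -> 0 < (x^T *m A *m x) 0 0.

Definition krylov (R : realType) (n : nat) (A : 'M[R]_n) (r0 : 'cV[R]_n)
    (k : nat) : {vspace 'cV[R]_n} :=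
  <<[seq A ^+ i *m r0 | i <- iota 0 k]>>%VS.

(* The matrix [s_{k-m_k} ... s_k] with m_k = min{k,m}; applied to the p's and
   the q's it gives P_{k+1} and Q_{k+1}. *)
Definition window (R : realType) (n m : nat) (s : nat -> 'cV[R]_n) (k : nat) :
    'M[R]_(n, (minn k m).+1) :=
  \matrix_(i, j) s (k - minn k m + j)%N i 0.

(* L_{k+1} = P_{k+1}^T Q_{k+1} *)
Definition SWI_L (R : realType) (n m : nat) (p q : nat -> 'cV[R]_n) (k : nat) :
    'M[R]_((minn k m).+1) :=
  (window m p k)^T *m window m q k.

Definition SWI_init (R : realType) (n : nat) (A : 'M[R]_n) (b : 'cV[R]_n)
    (x r p q : nat -> 'cV[R]_n) : Prop :=
  [/\ x 0%N = 0, r 0%N = b, p 0%N = r 0%N & q 0%N = A *m p 0%N].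

Definition SWI_well_defined (R : realType) (n m : nat)
    (p q : nat -> 'cV[R]_n) (k : nat) : Prop :=
  dotc (p k) (q k) != 0 /\ SWI_L m p q k \in unitmx.

Definition SWI_iteration (R : realType) (n : nat) (A : 'M[R]_n) (m : nat)
    (x r p q : nat -> 'cV[R]_n) (k : nat) : Prop :=
  let alpha := dotc (r k) (p k) / dotc (p k) (q k) in
  let v := A *m r k.+1 in
  [/\ x k.+1 = x k + alpha *: p k,
      r k.+1 = r k - alpha *: q k
    & exists lambda : 'cV[R]_((minn k m).+1),
        [/\ SWI_L m p q k *m lambda = (window m p k)^T *m v,
            p k.+1 = r k.+1 - window m p k *m lambda
          & q k.+1 = v - window m q k *m lambda]].

(* The entries of x, r, p, q of index at most K are those generated by SWI, all
   of the iterations 0, ..., K-1 being well defined; the entries of index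
   greater than K are unconstrained, so the algorithm may break down later. *)
Definition SWI_generated (R : realType) (n : nat) (A : 'M[R]_n)
    (b : 'cV[R]_n) (m : nat) (x r p q : nat -> 'cV[R]_n) (K : nat) : Prop :=
  SWI_init A b x r p q /\
  forall k, (k < K)%N ->
    SWI_well_defined m p q k /\ SWI_iteration A m x r p q k.

(* Main.v *)
Require Import Defs.
From HB Require Import structures.
From mathcomp Require Import all_boot all_order all_algebra.
From mathcomp Require Import reals.

Set Implicit Arguments.
Unset Strict Implicit.
Unset Printing Implicit Defensive.

Import Order.TTheory GRing.Theory Num.Theory.
Local Open Scope ring_scope.

(** The update of [q] avoids a product with [A], but the invariant
    [q j = A *m p j] persists by linearity, since the same coefficients
    [lambda] combine the [p j] and the [q j].  So [r] moves by a multiple of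
    [A *m p k], and the claim follows by induction from
    [A K_k <= K_{k+1}] and [K_k <= K_{k+1}]. *)

Lemma krylov_le (R : realType) (n : nat) (A : 'M[R]_n) (r0 : 'cV[R]_n)
    (j k : nat) : (j <= k)%N -> (krylov A r0 j <= krylov A r0 k)%VS.
Proof.
move=> le_jk; apply: sub_span => _ /mapP[i + ->]; rewrite mem_iota => /= lt_ij.
by apply: map_f; rewrite mem_iota /= (leq_trans lt_ij).
Qed.

(** A linear map sends a span to the span of the images, and multiplication by [A] turns the
    generator with exponent [i] into the one with exponent [i.+1]. *)
Lemma mem_krylov_mulmx (R : realType) (n : nat) (A : 'M[R]_n)
    (r0 u : 'cV[R]_n) (k : nat) :
  u \in krylov A r0 k -> A *m u \in krylov A r0 k.+1.
Proof.
move=> Ku; have := memv_img (linfun (mulmx A)) Ku.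
rewrite lfunE limg_span /=; apply: subvP; apply: sub_span.
move=> _ /mapP[_ /mapP[i + ->] ->]; rewrite mem_iota => /andP[_ lt_ik].
apply/mapP; exists i.+1; first by rewrite mem_iota.
by rewrite lfunE /= mulmxA exprS.
Qed.

(** Lets the induction hypothesis apply to every column of the window. *)
Lemma window_index_le (m k : nat) (j : 'I_(minn k m).+1) :
  (k - minn k m + j <= k)%N.
Proof. by rewrite -leq_subRL ?leq_subr // subKn ?geq_minl // -ltnS. Qed.

Lemma window_mulmx (R : realType) (n m : nat) (s : nat -> 'cV[R]_n) (k : nat)
    (c : 'cV[R]_(minn k m).+1) :
  window m s k *m c = \sum_j c j 0 *: s (k - minn k m + j)%N.
Proof.
apply/colP => i; rewrite mxE summxE; apply: eq_bigr => j _.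
by rewrite !mxE mulrC.
Qed.

Lemma SWI_invariant (R : realType) (n : nat) (A : 'M[R]_n) (b : 'cV[R]_n)
    (m : nat) (x r p q : nat -> 'cV[R]_n) (K : nat) :
  SWI_generated A b m x r p q K ->
  forall k, (k <= K)%N ->
  [/\ x k \in krylov A (r 0%N) k, r k \in krylov A (r 0%N) k.+1,
      p k \in krylov A (r 0%N) k.+1 & q k = A *m p k].
Proof.
(* Strong induction, since the window reaches back to directions older than [p k]. *)
case=> -[x0 _ p0 q0] step; elim/ltn_ind => -[_ _ | k IH lt_kK].
  have Kr0 : r 0%N \in krylov A (r 0%N) 1.
    by apply: memv_span; rewrite mem_seq1 expr0 mul1mx.
  by rewrite x0 q0 p0 mem0v.
have [_ [xE rE [c [_ pE qE]]]] := step k lt_kK.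
(* Nesting of the Krylov spaces puts all earlier directions into one common space. *)
have IHk j : (j <= k)%N -> p j \in krylov A (r 0%N) k.+1 /\ q j = A *m p j.
  move=> le_jk; have [_ _ Kp qj] := IH j le_jk (leq_trans le_jk (ltnW lt_kK)).
  by split=> //; apply: subvP Kp; apply: krylov_le.
have [Kx Kr Kp qk] := IH k (ltnSn k) (ltnW lt_kK).
(* Only the term [A *m p k] raises the dimension index; the bound is reused for [p k.+1], which is
   [r k.+1] corrected by window columns. *)
have Kr1 : r k.+1 \in krylov A (r 0%N) k.+2.
  rewrite rE qk rpredB ?rpredZ ?mem_krylov_mulmx //.
  exact: subvP (krylov_le _ _ (leqnSn _)) _ Kr.
split=> //.
- by rewrite xE rpredD ?rpredZ //; apply: subvP (krylov_le _ _ (leqnSn _)) _ Kx.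
- rewrite pE rpredB // window_mulmx rpred_sum // => j _; rewrite rpredZ //.
  apply: subvP (krylov_le _ _ (leqnSn _)) _ _.
  by have [] := IHk _ (window_index_le j).
- rewrite qE pE mulmxBr !window_mulmx mulmx_sumr; congr (_ - _).
  apply: eq_bigr => j _; rewrite -scalemxAr.
  by have [_ ->] := IHk _ (window_index_le j).
Qed.

Theorem lemma3p4 (R : realType) (n : nat) (A : 'M[R]_n) (b : 'cV[R]_n)
    (m : nat) (hA : posdef A) (x r p q : nat -> 'cV[R]_n) (k : nat)
    (hgen : SWI_generated A b m x r p q k) :
  [/\ x k \in krylov A (r 0%N) k,
      r k \in krylov A (r 0%N) k.+1
    & p k \in krylov A (r 0%N) k.+1].
Proof. by have [] := SWI_invariant hgen (leqnn k). Qed.
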